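(* Let $q\in\left(\frac25,\frac23\right)$. Then, for every choice of the initial labels $\rho:\mathbb{Z}^2\to\{\mathcal{H},\mathcal{V}\}$, the $\mathcal{H}$–$\mathcal{V}$ walk with parameter $q$, with a single walker and with initial labels $\rho$, is recurrent, i.e., almost surely every vertex of $\mathbb{Z}^2$ is visited infinitely many times.
   Context: $\mathcal{H}$–$\mathcal{V}$ walk on $\mathbb{Z}^2$ with parameter $q$ and a single walker: each vertex of $\mathbb{Z}^2$ carries a label $\mathcal{H}$ or $\mathcal{V}$ (initially given by $\rho$), and the walker starts at the origin $(0,0)$. At each discrete time step, the walker first changes the label of its current location $x$ ($\mathcal{H}$ to $\mathcal{V}$, or $\mathcal{V}$ to $\mathcal{H}$) with probability $q$ and keeps it with probability $1-q$, independently of the past. Then, if the new label at $x$ is $\mathcal{H}$ it moves to $x+(1,0)$ or $x-(1,0)$ with probability $\frac12$ each, and if the new label is $\mathcal{V}$ it moves to $x+(0,1)$ or $x-(0,1)$ with probability $\frac12$ each, independently of the past. *)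

(* Defs.v *)
From HB Require Import structures.
From mathcomp Require Export all_boot all_order all_algebra.
From mathcomp Require Export all_classical all_reals all_analysis.

Set Implicit Arguments.
Unset Strict Implicit.
Unset Printing Implicit Defensive.

Import Order.TTheory GRing.Theory Num.Theory.
Import numFieldNormedType.Exports.

Local Open Scope classical_set_scope.
Local Open Scope ring_scope.

Definition mutually_independent d d' (T : measurableType d)
    (T' : measurableType d') (R : realType) (P : probability T R)
    (I : choiceType) (X : I -> {RV P >-> T'}) : Prop :=
  forall (J : seq I) (B : I -> set T'), uniq J ->
    (forall i, measurable (B i)) ->
    P (\bigcap_(i in [set` J]) (X i @^-1` B i)) =
    (\prod_(i <- J) P (X i @^-1` B i))%E.

Definition vertex : Type := (int * int)%type.

Inductive label : Type := H | V.

Definition swap (l : label) : label := if l is H then V else H.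

Definition move (l : label) (forward : bool) (x : vertex) : vertex :=
  let e : int := if forward then 1 else - 1 in
  match l with
  | H => (x.1 + e, x.2)
  | V => (x.1, x.2 + e)
  end.

Definition state : Type := (vertex * (vertex -> label))%type.

Definition hv_step (flip forward : bool) (s : state) : state :=
  let: (x, lab) := s in
  let l := if flip then swap (lab x) else lab x in
  (move l forward x, fun y => if y == x then l else lab y).

(* [flip n] and [forward n] are the two coin tosses of step number [n]. *)
Fixpoint hv_state (rho : vertex -> label) (flip forward : nat -> bool)
    (n : nat) : state :=
  if n is m.+1 then
    hv_step (flip m) (forward m) (hv_state rho flip forward m)
  else ((0, 0), rho).

Definition hv_position (rho : vertex -> label) (flip forward : nat -> bool)
    (n : nat) : vertex := (hv_state rho flip forward n).1.

Section coins.
Context d (T : measurableType d) (R : realType) (P : probability T R).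
Implicit Types flip forward : nat -> {RV P >-> bool}.

Definition all_coins flip forward (i : nat + nat) : {RV P >-> bool} :=
  match i with inl n => flip n | inr n => forward n end.

(* The coins of both kinds form one jointly independent family: this is what
   makes each toss independent of the whole past, including, for [forward n],
   of the toss [flip n] made earlier in the same step. *)
Definition hv_coins (q : R) flip forward : Prop :=
  [/\ forall n, P (flip n @^-1` [set true]) = q%:E,
      forall n, P (forward n @^-1` [set true]) = (2^-1)%:E
    & mutually_independent (all_coins flip forward)].

Definition hv_walk (rho : vertex -> label) flip forward (n : nat) (w : T) :
    vertex :=
  hv_position rho (fun k => flip k w) (fun k => forward k w) n.

Definition recurrent (X : nat -> T -> vertex) : Prop :=
  \forall w \ae P, forall v : vertex, infinite_set [set n | X n w = v].

End coins.

(* Main.v *)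
Require Import Defs.
From mathcomp Require Import all_boot all_order all_algebra.
From mathcomp Require Import all_classical all_reals all_analysis.
From mathcomp Require Import ring lra zify.

(** Why the walk is recurrent.

    The position is a martingale that moves horizontally or vertically, so a
    planar Lyapunov function is natural: [potential], essentially the logarithm
    of the square norm, which is strictly superharmonic off the origin
    ([drift_lt0]).  It is superharmonic only for the average of a horizontal
    and a vertical step.  At a single vertex the mean increment also contains
    a multiple of [bias], whose sign depends on the current label.  This term is
    compensated by attaching to each vertex a weight [tilt] that depends on
    its label: a flip moves the weight by just the right amount on average, so
    [lyapunov], the potential of the position plus the weights of all vertices
    in a large box of radius [r], is a supermartingale inside the box
    ([avg_lyapunov]).

    Whatever the labels are, the weights in the box cannot change the total by
    more than [|1 - 2q| / q] times the sum of [|bias|], which is at most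
    [4 ln r + O(1)] ([box_bias_le]), whereas the potential outside the box is
    at least [2 ln r].  The condition [2/5 < q < 2/3] says exactly that
    [4 |1 - 2q| / q < 2], so the potential wins, and optional stopping
    ([avoid_supermartingale]) bounds the probability of never reaching the
    origin by a constant less than one that is the same for all starting
    positions and labels ([avoid_bounded]).  By the Markov property a chance of
    success bounded below means almost sure success ([avoid_to0]).

    All of this concerns real numbers defined by recursion on the number of
    steps.  The coins enter at the end: after every finite word of tosses the
    walk is a walk started afresh from some state, hence, by translation, it
    almost surely comes back to any given vertex ([negligible_escape]), and
    there are only countably many words and vertices. *)

Set Implicit Arguments.
Unset Strict Implicit.
Unset Printing Implicit Defensive.
Import Order.TTheory GRing.Theory Num.Theory.
Local Open Scope ring_scope.

(** * One-step averages and the probability of avoiding the origin *)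

Section Averaging.
Context {R : realType} (q : R).
Hypothesis q01 : 0 < q < 1.
Implicit Types (F G : state -> R) (s : state).

Definition avg F s : R :=
  q * ((F (hv_step true true s) + F (hv_step true false s)) / 2) +
  (1 - q) * ((F (hv_step false true s) + F (hv_step false false s)) / 2).

Lemma avg_le F G s :
  (forall b c, F (hv_step b c s) <= G (hv_step b c s)) -> avg F s <= avg G s.
Proof.
move: q01 => /andP[q0 q1] FG; apply: lerD; apply: ler_wpM2l; try lra.
  by have := FG true true; have := FG true false; lra.
by have := FG false true; have := FG false false; lra.
Qed.

Lemma avg_affine a b c F G s :
  avg (fun t => a * F t + b * G t + c) s = a * avg F s + b * avg G s + c.
Proof. by rewrite /avg; field. Qed.

Lemma avg_cst a s : avg (fun=> a) s = a.
Proof. by rewrite /avg; field. Qed.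

(** Probability that the walk started from [s] is not at the origin at any of
    the times [0, ..., N]. *)
Fixpoint avoid N s : R :=
  if s.1 == (0, 0) then 0 else if N is M.+1 then avg (avoid M) s else 1.

Lemma avoid_at0 N s : s.1 = (0, 0) -> avoid N s = 0.
Proof. by case: N => [|N] /= ->. Qed.

Lemma avoidS N s : s.1 != (0, 0) -> avoid N.+1 s = avg (avoid N) s.
Proof. by move=> /negPf /= ->. Qed.

Lemma avoid_ge0 N s : 0 <= avoid N s.
Proof.
elim: N s => [|N IH] s /=; case: eqP => // _.
by rewrite -(avg_cst 0 s); apply: avg_le.
Qed.

Lemma avoid_le1 N s : avoid N s <= 1.
Proof.
elim: N s => [|N IH] s /=; case: eqP => // _.
by rewrite -[leRHS](avg_cst 1 s); apply: avg_le.
Qed.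

Lemma avoid_leS N s : avoid N.+1 s <= avoid N s.
Proof.
elim: N s => [|N IH] s.
  by rewrite [leRHS]/=; case: eqP => [/avoid_at0->//|_]; apply: avoid_le1.
have [s0|s0] := eqVneq s.1 (0, 0); first by rewrite !avoid_at0.
by rewrite avoidS // [leRHS]avoidS //; apply: avg_le.
Qed.

Lemma avoid_nonincreasing M N s : (M <= N)%N -> avoid N s <= avoid M s.
Proof.
elim: N => [|N IH]; first by rewrite leqn0 => /eqP->.
rewrite leq_eqVlt => /predU1P[->//|/IH]; apply: le_trans; exact: avoid_leS.
Qed.

(** The Markov property at time [N]: only finitely many states can be reached
    by then, so the horizons that suffice after time [N] have a maximum. *)
Lemma avoid_contract t : (forall s, exists N, avoid N s <= t) ->
  forall N s, exists M, avoid (N + M) s <= t * avoid N s.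
Proof.
move=> tP; elim=> [|N IH] s.
  have [s0|s0] := eqVneq s.1 (0, 0).
    by exists 0%N; rewrite !avoid_at0 ?mulr0.
  by have [M sM] := tP s; exists M; rewrite /= (negPf s0) mulr1.
have [s0|s0] := eqVneq s.1 (0, 0).
  by exists 0%N; rewrite !avoid_at0 ?mulr0.
have /choice[M MP] (bc : bool * bool) := IH (hv_step bc.1 bc.2 s).
exists (\sum_bc M bc)%N; rewrite addSn !avoidS //.
have -> : t * avg (avoid N) s = avg (fun u => t * avoid N u + 0 * 0 + 0) s.
  by rewrite (avg_affine t 0 0 _ (fun=> 0)) mul0r !addr0.
apply: avg_le => b c; rewrite mul0r !addr0.
apply: le_trans (MP (b, c)); apply: avoid_nonincreasing.
by rewrite leq_add2l (bigD1 (b, c)) //= leq_addr.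
Qed.

(** A walk that has a chance at least [1 - t] of reaching the origin from every
    state reaches it almost surely, since failing [m] times in a row has
    probability at most [t ^+ m]. *)
Lemma avoid_to0 t : 0 < t < 1 -> (forall s, exists N, avoid N s <= t) ->
  forall s e, 0 < e -> exists N, avoid N s < e.
Proof.
move=> /andP[t0 t1] tP s e e0.
have pw m : forall s, exists N, avoid N s <= t ^+ m.
  elim: m => [|m IH] s'; first by exists 0%N; rewrite expr0 avoid_le1.
  have [N sN] := tP s'; have [M NM] := avoid_contract IH N s'.
  exists (N + M)%N; apply: le_trans NM _; rewrite exprSr.
  by apply: ler_wpM2l => //; rewrite exprn_ge0// ltW.
have /cvgrPdist_lt/(_ e e0)[m _ /(_ m (leqnn m))] :
    (GRing.exp t @ \oo --> 0)%classic.
  by apply: cvg_expr; rewrite ger0_norm ?ltW.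
rewrite /= sub0r normrN ger0_norm ?exprn_ge0 ?ltW// => tme.
by have [N /le_lt_trans/(_ tme)] := pw m s; exists N.
Qed.

(** Expected value of [F] at time [N] for the walk frozen on leaving [D]. *)
Fixpoint stop (D : pred vertex) N F s : R :=
  if N is M.+1 then if D s.1 then avg (stop D M F) s else F s else F s.

Lemma stop_le D N F G s : (forall s, F s <= G s) -> stop D N F s <= stop D N G s.
Proof.
move=> FG; elim: N s => [|N IH] s //=; case: ifP => // _; exact: avg_le.
Qed.

Lemma stop_affine (D : pred vertex) N a b c F G s :
  stop D N (fun t => a * F t + b * G t + c) s =
  a * stop D N F s + b * stop D N G s + c.
Proof.
elim: N s => [|N IH] s //=; case: ifP => // _.
by rewrite -avg_affine; congr avg; apply/funext.
Qed.

Lemma stop_cst (D : pred vertex) N a s : stop D N (fun=> a) s = a.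
Proof.
elim: N s => [|N IH] s //=; case: ifP => // _.
by rewrite -[RHS](avg_cst a s); congr avg; apply/funext.
Qed.

Lemma avoid_le_stop (D : pred vertex) N s : ~~ D (0, 0) ->
  avoid N s <= stop D N (fun t => (t.1 != (0, 0))%:R) s.
Proof.
move=> D0; elim: N s => [|N IH] s /=; case: eqP => [s0|s0] //=.
  by rewrite s0 (negPf D0).
case: ifP => _; first exact: avg_le.
by rewrite -[leRHS](avg_cst 1 s); apply: avg_le => b c; apply: avoid_le1.
Qed.

(** The walk is still in [D] at time [N] only if it paid [k] at each of the [N]
    preceding steps. *)
Lemma stop_drift (D : pred vertex) N F k s : 0 <= k ->
  (forall t, D t.1 -> avg F t <= F t - k) ->
  stop D N F s <= F s - k * N%:R * stop D N (fun t => (D t.1)%:R) s.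
Proof.
move=> k0 FD; elim: N s => [|N IH] s /=; first by rewrite mulr0 mul0r subr0.
case: ifP => [Ds|_]; last by rewrite mulr0 subr0.
set d := stop D N (fun t => (D t.1)%:R).
have d1 : avg d s <= 1.
  rewrite -[leRHS](avg_cst 1 s); apply: avg_le => b c.
  rewrite -[leRHS](stop_cst D N 1 (hv_step b c s)).
  by apply: stop_le => t; rewrite lern1 leq_b1.
apply: (@le_trans _ _ (avg (fun t => 1 * F t + - (k * N%:R) * d t + 0) s)).
  by apply: avg_le => b c; have := IH (hv_step b c s); rewrite -/d; lra.
rewrite avg_affine; have := FD s Ds; rewrite -natr1.
have := ler_wpM2l k0 d1; lra.
Qed.

(** Optional stopping.  The mean of [F] does not increase until the walk leaves
    [D], so a loss of at most [A] must pay for the additional gain [B] made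
    whenever the walk leaves [D] elsewhere than at the origin.  The strict
    decrease [k] makes the walk leave [D]. *)
Lemma avoid_supermartingale (D : pred vertex) F k A B s :
  ~~ D (0, 0) -> 0 < k -> 0 < B ->
  (forall t, D t.1 -> avg F t <= F t - k) ->
  (forall t, F s - A <= F t) ->
  (forall t, t.1 != (0, 0) -> ~~ D t.1 -> F s - A + B <= F t) ->
  forall e, 0 < e -> exists N, avoid N s <= A / B + e.
Proof.
move=> D0 k0 B0 FD FA FB e e0.
(* By time [N], remaining in [D] with probability [e] would cost [A]. *)
pose N := (Num.truncn (A / (k * e))).+1.
have NP : A <= k * e * N%:R.
  rewrite mulrC -ler_pdivrMr ?mulr_gt0//.
  by apply/ltW/truncnS_gt.
exists N.
have := stop_drift N s (ltW k0) FD.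
set d := stop D N (fun t => (D t.1)%:R) s => dF.
have FsA : F s - A <= stop D N F s.
  by rewrite -[leLHS](stop_cst D N _ s); apply: stop_le.
have N0 : 0 < N%:R :> R by rewrite ltr0n.
have de : d <= e.
  have : k * N%:R * d <= k * N%:R * e by lra.
  by rewrite ler_pM2l// mulr_gt0.
have d0 : 0 <= d.
  by rewrite -[leLHS](stop_cst D N _ s); apply: stop_le => t; rewrite ler0n.
have k1 : 0 <= k * N%:R * d by rewrite !mulr_ge0// ltW.
pose I := fun t : state => ((t.1 != (0, 0))%:R : R).
have : stop D N (fun t => B * I t + 0 * I t + 0) s <=
    stop D N (fun t => 1 * F t + B * (D t.1)%:R + (A - F s)) s.
  apply: stop_le => t; rewrite /I.
  have := FA t; have := FB t.
  case: eqP => [->|_]; rewrite ?(negPf D0) /=; first by lra.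
  by case: (D t.1) => /=; [lra|move=> /(_ isT isT); lra].
rewrite !stop_affine -/d => h.
have := avoid_le_stop N s D0; rewrite -/I => /le_trans; apply.
rewrite -(ler_pM2l B0) mulrDr mulrCA divff ?gt_eqF// mulr1.
have := ler_wpM2l (ltW B0) de; lra.
Qed.

End Averaging.

(** * A logarithmic superharmonic function *)

Section Potential.
Context {R : realType}.
Implicit Types x : vertex.

Definition sqnorm x : R := x.1%:~R ^+ 2 + x.2%:~R ^+ 2.

(** The constant [1/2] in place of [3/4] would still make the logarithm
    superharmonic, but with equality on the diagonals.  A constant less than [1]
    keeps the values positive, and the value at the origin is small enough for
    superharmonicity at its four neighbours. *)
Definition gauge x : R :=
  if x == (0, 0) then 2 ^- 11 else sqnorm x - 3 / 4.

Definition potential x : R := ln (gauge x).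

(** Mean increment of [potential] in a step taken from [x] with label [l]. *)
Definition drift (l : label) x : R :=
  (potential (move l true x) + potential (move l false x)) / 2 - potential x.

Definition bias x : R := (drift H x - drift V x) / 2.

Lemma sqnorm_ge1 x : x != (0, 0) -> 1 <= sqnorm x.
Proof.
case: x => a b ab; rewrite /sqnorm /= -!rmorphXn -rmorphD /= ler1z.
move: ab; rewrite xpair_eqE; nia.
Qed.

Lemma gauge_ge x : 2 ^- 11 <= gauge x.
Proof. by rewrite /gauge; case: ifPn => // /sqnorm_ge1; lra. Qed.

Lemma gauge_gt0 x : 0 < gauge x.
Proof. by have := gauge_ge x; lra. Qed.

Lemma gaugeE a b : (a, b) != (0, 0) ->
  gauge (a, b) = a%:~R ^+ 2 + b%:~R ^+ 2 - 3 / 4.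
Proof. by rewrite /gauge /sqnorm => /negPf->. Qed.

Lemma lnM4 (a b c e : R) : 0 < a -> 0 < b -> 0 < c -> 0 < e ->
  ln a + ln b + (ln c + ln e) = ln (a * b * (c * e)).
Proof. by move=> *; rewrite !lnM// posrE !mulr_gt0. Qed.

(** With [u = a^2 + b^2 + 1/4], the values at the four neighbours multiply to
    [(u^2 - 4 a^2) (u^2 - 4 b^2)], and [2 |a b| <= a^2 + b^2] makes this smaller
    than [(u - 1)^4].  Next to the origin, its tiny gauge decides. *)
Lemma gauge_superharmonic x : x != (0, 0) ->
  gauge (move H true x) * gauge (move H false x) *
  (gauge (move V true x) * gauge (move V false x)) <
  gauge x * gauge x * (gauge x * gauge x).
Proof.
case: x => a b x0 /=.
have [s1|s2] : (a ^+ 2 + b ^+ 2 = 1 \/ 2 <= a ^+ 2 + b ^+ 2)%R.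
- by move: x0; rewrite xpair_eqE; nia.
- have : (a, b) \in [:: (1, 0); (-1, 0); (0, 1); (0, -1)].
    by rewrite !inE !xpair_eqE; nia.
  by rewrite !inE => /or4P[] /eqP[-> ->]; rewrite /gauge /sqnorm /=; lra.
rewrite !gaugeE ?xpair_eqE//; try by nia.
rewrite !rmorphD /= !rmorphN1 !rmorph1.
have : 2 <= a%:~R ^+ 2 + b%:~R ^+ 2 :> R.
  by rewrite -!rmorphXn -rmorphD /= (ler_int R 2).
move: (a%:~R : R) (b%:~R : R) => X Y s.
have h : (2 * (X * Y)) ^+ 2 <= (X ^+ 2 + Y ^+ 2) ^+ 2.
  by have := sqr_ge0 (X ^+ 2 - Y ^+ 2); lra.
move: h s; set t := X ^+ 2 + Y ^+ 2 => h s.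
have -> : ((X + 1) ^+ 2 + Y ^+ 2 - 3 / 4) * ((X - 1) ^+ 2 + Y ^+ 2 - 3 / 4) *
  ((X ^+ 2 + (Y + 1) ^+ 2 - 3 / 4) * (X ^+ 2 + (Y - 1) ^+ 2 - 3 / 4)) =
  (t + 1 / 4) ^+ 4 - 4 * t * (t + 1 / 4) ^+ 2 + 4 * (2 * (X * Y)) ^+ 2.
  by rewrite /t; field.
have : 0 <= (t - 2) * (t - 2) by rewrite mulr_ge0; lra.
lra.
Qed.

Lemma drift_lt0 x : x != (0, 0) -> drift H x + drift V x < 0.
Proof.
move=> /gauge_superharmonic; rewrite -ltr_ln ?posrE ?mulr_gt0 ?gauge_gt0//.
by rewrite -!lnM4 ?gauge_gt0// /drift /potential; lra.
Qed.

Lemma gauge_swap (a b : int) : gauge (a, b) = gauge (b, a).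
Proof. by rewrite /gauge /sqnorm !xpair_eqE andbC /= (addrC (_ ^+ 2)). Qed.

Lemma gauge_opp1 (a b : int) : gauge (- a, b) = gauge (a, b).
Proof. by rewrite /gauge /sqnorm !xpair_eqE oppr_eq0 /= rmorphN sqrrN. Qed.

Lemma gauge_opp2 (a b : int) : gauge (a, - b) = gauge (a, b).
Proof. by rewrite (gauge_swap a (- b)) gauge_opp1 gauge_swap. Qed.

Lemma bias_swap (a b : int) : bias (a, b) = - bias (b, a).
Proof.
rewrite /bias /drift /potential /= (gauge_swap a b).
rewrite !(gauge_swap (a + _) b) !(gauge_swap a (b + _)).
lra.
Qed.

Lemma bias_opp1 (a b : int) : bias (- a, b) = bias (a, b).
Proof.
rewrite /bias /drift /potential /= !gauge_opp1.
rewrite -(gauge_opp1 (- a + 1)) -(gauge_opp1 (- a - 1)) !opprD !opprK.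
lra.
Qed.

Lemma bias_opp2 (a b : int) : bias (a, - b) = bias (a, b).
Proof. by rewrite (bias_swap a (- b)) bias_opp1 (bias_swap a). Qed.

(** The main term is a quarter of the difference of the two second derivatives
    of [ln (x^2 + y^2)].  It is exposed by writing [bias] as a single logarithm
    and using [ln (1 + z) <= z]. *)
Lemma bias_le (k j : nat) : (3 <= k)%N -> (j <= k)%N ->
  `|bias (k%:Z, j%:Z)| <=
  (k%:R ^+ 2 - j%:R ^+ 2) / (k%:R ^+ 2 + j%:R ^+ 2) ^+ 2 + 8 / k%:R ^+ 4 :> R.
Proof.
move=> k3 jk.
have X3 : 3 <= k%:R :> R by rewrite ler_nat.
have YX : j%:R <= k%:R :> R by rewrite ler_nat.
have Y0 : 0 <= j%:R :> R by rewrite ler0n.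
rewrite /bias /drift /potential /move /=.
set g1 := gauge (_ + 1, _); set g2 := gauge (_ - 1, _).
set g3 := gauge (_, _ + 1); set g4 := gauge (_, _ - 1).
have gp : [/\ 0 < g1, 0 < g2, 0 < g3 & 0 < g4] by split; apply: gauge_gt0.
case: gp => p1 p2 p3 p4.
have -> : ((ln g1 + ln g2) / 2 - ln (gauge (k%:Z, j%:Z)) -
  ((ln g3 + ln g4) / 2 - ln (gauge (k%:Z, j%:Z)))) / 2 =
  - (ln (g3 * g4 / (g1 * g2)) / 4).
  by rewrite ln_div ?posrE ?mulr_gt0// !lnM ?posrE//; field.
move: p1 p2 p3 p4; rewrite /g1 /g2 /g3 /g4 !gaugeE ?xpair_eqE; try by lia.
rewrite !rmorphD /= !rmorphN1 !rmorph1 -!pmulrn.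
move: (k%:R : R) (j%:R : R) X3 YX Y0 => X Y X3 YX Y0.
set G1 := (_ + _ - _); set G2 := (_ + _ - _).
set G3 := (_ + _ - _); set G4 := (_ + _ - _) => p1 p2 p3 p4.
set s := X ^+ 2 + Y ^+ 2.
have G12 : G1 * G2 = (s + 1 / 4) ^+ 2 - 4 * X ^+ 2.
  by rewrite /G1 /G2 /s; field.
have G34 : G3 * G4 = (s + 1 / 4) ^+ 2 - 4 * Y ^+ 2.
  by rewrite /G3 /G4 /s; field.
have X9 : 9 <= X ^+ 2 by nra.
have s9 : 9 <= s by rewrite /s; nra.
have YX2 : 0 <= X ^+ 2 - Y ^+ 2 by nra.
have p12 : 0 < G1 * G2 by apply: mulr_gt0.
have q12 : 0 < s ^+ 2 - 4 * s by nra.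
have le12 : s ^+ 2 - 4 * s <= G1 * G2 by rewrite G12 /s; nra.
have r1 : 1 <= G3 * G4 / (G1 * G2).
  by rewrite ler_pdivlMr// mul1r G12 G34; lra.
rewrite normrN ger0_norm; last by rewrite divr_ge0// ln_ge0.
apply: (@le_trans _ _ ((X ^+ 2 - Y ^+ 2) / (G1 * G2))).
  have -> : G3 * G4 / (G1 * G2) = 1 + 4 * ((X ^+ 2 - Y ^+ 2) / (G1 * G2)).
    have -> : G3 * G4 = G1 * G2 + 4 * (X ^+ 2 - Y ^+ 2) by rewrite G12 G34; lra.
    by rewrite mulrDl divff ?gt_eqF// mulrA.
  rewrite ler_pdivrMr// mulrC; apply: le_ln1Dx.
  have : 0 <= (X ^+ 2 - Y ^+ 2) / (G1 * G2) by rewrite divr_ge0// ltW.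
  lra.
apply: (@le_trans _ _ ((X ^+ 2 - Y ^+ 2) / (s ^+ 2 - 4 * s))).
  by apply: ler_wpM2l => //; rewrite lef_pV2.
have s0 : 0 < s by lra.
apply: (@le_trans _ _ ((X ^+ 2 - Y ^+ 2) / s ^+ 2 + 8 / s ^+ 2)); last first.
  rewrite lerD2l; apply: ler_wpM2l; first lra.
  rewrite lef_pV2 ?posrE ?exprn_gt0//; last lra.
  have -> : X ^+ 4 = (X ^+ 2) ^+ 2 by rewrite -exprM.
  rewrite ler_sqr ?nnegrE; rewrite /s; nra.
rewrite -mulrDl ler_pdivrMr// mulrAC ler_pdivlMr ?exprn_gt0//.
have : X ^+ 2 - Y ^+ 2 <= s by rewrite /s; nra.
move: (X ^+ 2 - Y ^+ 2) YX2 => D D0 Ds; rewrite expr2; nra.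
Qed.

End Potential.

(** * The total bias of a box *)

Definition mirrors (k j : int) : seq vertex :=
  [:: (k, j); (k, - j); (- k, j); (- k, - j);
      (j, k); (j, - k); (- j, k); (- j, - k)].

(** Points on the axes and the diagonals are listed more than once: this keeps
    the sums of symmetric functions simple and only weakens upper bounds. *)
Definition box (r : nat) : seq vertex :=
  flatten [seq flatten [seq mirrors k%:Z j%:Z | j <- iota 0 k.+1]
          | k <- iota 1 r].

Lemma mem_box r (x : vertex) : x != (0, 0) ->
  (`|x.1| <= r)%N -> (`|x.2| <= r)%N -> x \in box r.
Proof.
case: x => a b x0 /= ar br.
pose k := maxn `|a| `|b|; pose j := minn `|a| `|b|.
apply/flattenP; exists (flatten [seq mirrors k%:Z i%:Z | i <- iota 0 k.+1]).
  apply/mapP; exists k => //; rewrite mem_iota.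
  by move: x0; rewrite xpair_eqE /k; lia.
apply/flattenP; exists (mirrors k%:Z j%:Z).
  by apply/mapP; exists j => //; rewrite mem_iota /k /j; lia.
rewrite /k /j !inE; case: a b {x0 ar br k j} => m [] n; rewrite ?NegzE ?abszN /=;
  by case: leqP => _; rewrite !eqxx ?orbT.
Qed.

Section BoxSum.
Context {R : realType}.

Lemma gauge_outside r (x : vertex) : x != (0, 0) -> x \notin box r ->
  r%:R ^+ 2 <= gauge x :> R.
Proof.
move=> x0 xr; have : (r%:Z + 1) ^+ 2 <= x.1 ^+ 2 + x.2 ^+ 2.
  have : ~~ ((`|x.1| <= r)%N && (`|x.2| <= r)%N).
    by apply: contra xr => /andP[]; exact: mem_box.
  rewrite negb_and -!ltnNge => /orP[]; move: (x.1) (x.2) => a b; nia.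
rewrite -(ler_int R) [x in gauge x]surjective_pairing gaugeE//.
rewrite rmorphD !rmorphXn /= rmorphD /= -pmulrn.
have : 0 <= r%:R :> R by []; nra.
Qed.

Definition shell_bias (k : nat) : R :=
  \sum_(0 <= j < k.+1) `|bias (k%:Z, j%:Z)|.

Lemma box_biasE r :
  \sum_(x <- box r) `|bias x| = 8 * \sum_(1 <= k < r.+1) shell_bias k :> R.
Proof.
rewrite big_flatten big_map /index_iota subSS subn0 mulr_sumr.
apply: eq_bigr => k _; rewrite big_flatten big_map /shell_bias mulr_sumr.
rewrite /index_iota subn0; apply: eq_bigr => j _.
rewrite !big_cons big_nil !bias_opp1 !bias_opp2 (bias_swap j) normrN.
by rewrite mulr_natl !mulrS mulr0n.
Qed.

(** The summand is a decreasing derivative: it is at most the increment of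
    [y / (k^2 + y^2)] over the preceding unit interval. *)
Lemma telescope_shell (k m : nat) : (0 < k)%N -> (m <= k)%N ->
  \sum_(0 <= j < m.+1)
    (k%:R ^+ 2 - j%:R ^+ 2) / (k%:R ^+ 2 + j%:R ^+ 2) ^+ 2 <=
  k%:R ^- 2 + m%:R / (k%:R ^+ 2 + m%:R ^+ 2) :> R.
Proof.
move=> k0; have X0 : 0 < k%:R :> R by rewrite ltr0n.
elim: m => [_|m IH mk].
  rewrite big_nat1 expr0n /= subr0 addr0 mul0r addr0.
  by rewrite le_eqVlt; apply/orP; left; apply/eqP; field; rewrite gt_eqF.
rewrite big_nat_recr //=; apply: le_trans (lerD (IH (ltnW mk)) (lexx _)) _.
have : m.+1%:R <= k%:R :> R by rewrite ler_nat.
have : 0 <= m%:R :> R by [].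
rewrite -natr1; move: (k%:R : R) (m%:R : R) X0 => X y X0 y0 yX.
rewrite -addrA lerD2l -lerBrDl.
set s := X ^+ 2 + (y + 1) ^+ 2; set s' := X ^+ 2 + y ^+ 2.
have s'0 : 0 < s' by rewrite /s'; nra.
have ss' : s' <= s by rewrite /s /s'; nra.
have s0 : 0 < s by lra.
have -> : (y + 1) / s - y / s' = (X ^+ 2 - y * (y + 1)) / (s * s').
  rewrite -mulNr addf_div ?gt_eqF//; congr (_ / _); rewrite /s /s'; ring.
apply: (@le_trans _ _ ((X ^+ 2 - (y + 1) ^+ 2) / (s * s'))).
  apply: ler_wpM2l; first nra.
  by rewrite lef_pV2 ?posrE ?mulr_gt0 ?exprn_gt0// expr2 ler_pM2l.
by apply: ler_wpM2r; [rewrite invr_ge0 mulr_ge0// ltW|lra].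
Qed.

Lemma shell_bias_le k : (3 <= k)%N ->
  shell_bias k <= k%:R^-1 / 2 + 17 / k%:R ^+ 2.
Proof.
move=> k3; have k0 : (0 < k)%N by lia.
have X3 : 3 <= k%:R :> R by rewrite ler_nat.
apply: (@le_trans _ _ (\sum_(0 <= j < k.+1)
    ((k%:R ^+ 2 - j%:R ^+ 2) / (k%:R ^+ 2 + j%:R ^+ 2) ^+ 2 + 8 / k%:R ^+ 4))).
  by apply: ler_sum_nat => j /andP[_ jk]; apply: bias_le.
rewrite big_split /= sumr_const_nat subn0.
apply: le_trans (lerD (telescope_shell k0 (leqnn k)) (lexx _)) _.
rewrite -[_ *+ k.+1]mulr_natl -[k.+1%:R]natr1; move: (k%:R : R) X3 => X X3.
have X0 : X != 0 by lra.
have -> : X / (X ^+ 2 + X ^+ 2) = X^-1 / 2.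
  by rewrite -mulr2n -mulr_natl; field.
have -> : (X + 1) * (8 / X ^+ 4) = 8 * (X + 1) / X ^+ 2 / X ^+ 2 by field.
have h : 8 * (X + 1) / X ^+ 2 <= 16 by rewrite ler_pdivrMr ?exprn_gt0; nra.
have i0 : 0 <= X ^- 2 by rewrite invr_ge0 exprn_ge0//; lra.
have := ler_wpM2r i0 h; lra.
Qed.

(** The shell of radius [k] consists of eight half-sides, each contributing
    [1 / (2 k)] up to a summable error: this is where the constant [4] comes
    from. *)
Lemma box_bias_le : exists C : R, forall r, (2 <= r)%N ->
  \sum_(x <- box r) `|bias x| <= 4 * ln r%:R + C.
Proof.
(* [68 = 136 / 2] starts the telescoping bound [1 / k^2 <= 1 / (k-1) - 1 / k]
   for the error terms, whose total coefficient is [8 * 17 = 136]. *)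
pose C : R := \sum_(x <- box 2) `|bias x| + 68.
suff H r : (2 <= r)%N ->
    \sum_(x <- box r) `|bias x| <= 4 * ln r%:R + C - 136 / r%:R.
  exists C => r r2; apply: le_trans (H r r2) _.
  by rewrite gerBl divr_ge0.
elim: r => // r IH; rewrite leq_eqVlt => /predU1P[<-|r2].
  have := ln_ge0 (ler1n R 2); rewrite /C => h.
  have -> : 136 / 2 = 68 :> R by lra.
  by rewrite addrA addrK ler_wpDl// mulr_ge0.
have := IH r2; rewrite !box_biasE (@big_nat_recr _ _ _ r.+1)//= mulrDr => {}IH.
have := @shell_bias_le r.+1 r2; set S := shell_bias _ => Sr.
have r0 : 0 < r%:R :> R by rewrite ltr0n; lia.
have r10 : 0 < r.+1%:R :> R by rewrite ltr0n.
have lnr : r.+1%:R^-1 <= ln r.+1%:R - ln r%:R :> R.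
  have -> : r%:R = r.+1%:R * (1 - r.+1%:R^-1) :> R.
    by rewrite mulrBr divff ?gt_eqF// mulr1 -natr1 addrK.
  have p : r.+1%:R^-1 < 1 :> R by rewrite invf_lt1// ltr1n; lia.
  rewrite lnM ?posrE ?subr_gt0//.
  have := @le_ln1Dx R (- r.+1%:R^-1); rewrite ltrN2 => /(_ p).
  by rewrite opprD addrA subrr sub0r lerNr.
have sq : r.+1%:R ^- 2 <= r%:R^-1 - r.+1%:R^-1 :> R.
  have -> : r%:R^-1 - r.+1%:R^-1 = r%:R^-1 * r.+1%:R^-1 :> R.
    by rewrite -natr1 in r10 *; field; rewrite !gt_eqF.
  rewrite expr2 invfM; apply: ler_wpM2r; first by rewrite invr_ge0 ltW.
  by rewrite lef_pV2 ?posrE// ler_nat.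
move: IH Sr lnr sq; move: (ln r.+1%:R) (ln r%:R) (r.+1%:R ^- 2).
by move: (r.+1%:R^-1) (r%:R^-1) (\sum_(_ <= _ < _) _) => *; lra.
Qed.

End BoxSum.

(** * The walk reaches the origin *)

Section Reaching.
Context {R : realType} (q : R).
Hypotheses (q_gt : 2 / 5 < q) (q_lt : q < 2 / 3).

(** A flip at [x] occurs with probability [q] and turns the tilt into its
    opposite.  The coefficient makes the mean change cancel the contribution
    [(1 - 2 q) * bias x], or its opposite, of the position. *)
Definition tilt (l : label) (x : vertex) : R :=
  (1 - 2 * q) / (2 * q) * (if l is H then bias x else - bias x).

Definition lyapunov r (s : state) : R :=
  potential s.1 + \sum_(y <- undup (box r)) tilt (s.2 y) y.

Lemma sum_tilt_update r (lab : vertex -> label) (x : vertex) l : x \in box r ->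
  \sum_(y <- undup (box r)) tilt (if y == x then l else lab y) y =
  \sum_(y <- undup (box r)) tilt (lab y) y + tilt l x - tilt (lab x) x.
Proof.
move=> xr; rewrite !(bigD1_seq x) ?mem_undup ?undup_uniq//= eqxx.
rewrite (eq_bigr (fun y => tilt (lab y) y)) => [|y /negPf->//]; lra.
Qed.

(** Only the weight of the current vertex changes in a step, and its mean change
    cancels the part of the increment of the potential that depends on the
    label, leaving the average of the two drifts. *)
Lemma avg_lyapunov r s : s.1 \in box r ->
  avg q (lyapunov r) s = lyapunov r s + (drift H s.1 + drift V s.1) / 2.
Proof.
case: s => x lab /= xr.
have q0 : q != 0 by rewrite gt_eqF//; move: q_gt q_lt; lra.
rewrite /avg /lyapunov /hv_step /= !sum_tilt_update// /tilt /bias.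
move: (\sum_(y <- _) _) => W; rewrite /drift.
by case: (lab x) => /=; field.
Qed.

Lemma sum_tilt_le r (lab lab' : vertex -> label) :
  \sum_(y <- undup (box r)) tilt (lab y) y -
  \sum_(y <- undup (box r)) tilt (lab' y) y <=
  `|1 - 2 * q| / q * \sum_(y <- box r) `|bias y|.
Proof.
have q0 : 0 < q by move: q_gt q_lt; lra.
apply: (@le_trans _ _
  (\sum_(y <- undup (box r)) `|1 - 2 * q| / q * `|bias y|)).
  rewrite -sumrB; apply: ler_sum => y _; rewrite /tilt.
  have -> : `|1 - 2 * q| / q * `|bias y| = `|(1 - 2 * q) / q * bias y|.
    by rewrite [RHS]normrM [X in _ = X * _]normrM [`|q^-1|]normfV (gtr0_norm q0).
  set b := (1 - 2 * q) / q * bias y.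
  have bE : (1 - 2 * q) / (2 * q) * bias y = b / 2.
    by rewrite /b; field; rewrite gt_eqF.
  have := ler_norm b; have := ler_norm (- b); rewrite normrN.
  have := normr_ge0 b.
  case: (lab y); case: (lab' y); rewrite ?mulrN bE; lra.
have c0 : 0 <= `|1 - 2 * q| / q by rewrite divr_ge0// ltW.
rewrite -mulr_sumr; apply: ler_wpM2l => //.
elim: (box r) => [|y s IH]; first by rewrite /= !big_nil.
rewrite /=; case: ifP => _; rewrite !big_cons ?lerD2l//.
by apply: le_trans IH _; rewrite lerDr.
Qed.

(** A finite box turns the strict inequality into a uniform one. *)
Lemma uniform_drift r : exists2 k : R, 0 < k & forall x, x \in box r ->
  x != (0, 0) -> (drift H x + drift V x) / 2 <= - k.
Proof.
elim: (box r) => [|y s [k k0 IH]]; first by exists 1.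
have [->|y0] := eqVneq y (0, 0).
  by exists k => // x; rewrite inE => /predU1P[->/eqP//|]; exact: IH.
have dy := @drift_lt0 R y y0.
exists (Num.min k (- ((drift H y + drift V y) / 2))).
  by rewrite lt_min k0 /=; lra.
move=> x; rewrite inE lerNr => /predU1P[-> _|xs x0].
  by rewrite ge_min lexx orbT.
by rewrite ge_min (lerNr k) IH.
Qed.

(** The weights in the box can lower [lyapunov] by at most [4 p ln r + O(1)],
    while the potential gains [2 ln r] outside, so that the walk avoids the
    origin with probability at most [2 p] in the limit of large [r], where
    [2 p < 1] is the condition on [q]. *)
Lemma avoid_bounded : exists2 t : R, 0 < t < 1 &
  forall s, exists N, avoid q N s <= t.
Proof.
pose p := `|1 - 2 * q| / q.
have q0 : 0 < q by move: q_gt q_lt; lra.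
have q01 : 0 < q < 1 by move: q_gt q_lt => *; apply/andP; split; lra.
have p0 : 0 <= p by rewrite divr_ge0// ltW.
have p1 : 2 * p < 1.
  suff : p < 1 / 2 by lra.
  rewrite ltr_pdivrMr//; by move: q_gt q_lt; case: (ger0P (1 - 2 * q)); lra.
exists ((1 + 2 * p) / 2); first by apply/andP; split; lra.
move=> s; have [s0|s0] := eqVneq s.1 (0, 0).
  by exists 0%N; rewrite avoid_at0//; lra.
have [C Cbox] := @box_bias_le R.
pose Z := potential s.1 - ln (2 ^- 11) + p * C.
(* [r] is taken so large that the constant [Z] is negligible against the
   growth [2 ln r] of the potential. *)
have [r r2 Zr] : exists2 r, (2 <= r)%N & Z <= (1 - 2 * p) / 4 * (2 * ln r%:R).
  pose y := Z / ((1 - 2 * p) / 4 * 2).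
  exists (Num.truncn (expR y)).+2 => //.
  have : y <= ln (Num.truncn (expR y)).+2%:R.
    rewrite -ler_expR lnK ?posrE ?ltr0n//.
    apply: le_trans (ltW (truncnS_gt _)) _; by rewrite ler_nat.
  by rewrite /y ler_pdivrMr; lra.
have [k k0 kP] := uniform_drift r.
have L0 : 0 < 2 * ln r%:R :> R by rewrite mulr_gt0// ln_gt0// ltr1n.
pose D := [pred x : vertex | (x \in box r) && (x != (0, 0))].
have pot0 x : ln (2 ^- 11) <= potential x :> R.
  by rewrite /potential ler_ln ?posrE ?gauge_gt0 ?gauge_ge// invr_gt0 exprn_gt0.
have low t : lyapunov r s - (4 * p * ln r%:R + Z) + potential t.1 - ln (2 ^- 11)
    <= lyapunov r t.
  have := sum_tilt_le r s.2 t.2; rewrite -/p.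
  have := ler_wpM2l p0 (Cbox r r2); rewrite /lyapunov /Z; lra.
have [N NP] : exists N, avoid q N s <=
    (4 * p * ln r%:R + Z) / (2 * ln r%:R) + (1 - 2 * p) / 4.
  apply: (avoid_supermartingale q01 (D := D) (F := lyapunov r) (k := k)) => //.
  - by rewrite /= andbF.
  - move=> t /andP[tr t0]; rewrite avg_lyapunov//.
    by have := kP _ tr t0; lra.
  - by move=> t; have := low t; have := pot0 t.1; lra.
  - move=> t t0; rewrite /= t0 andbT => tr.
    have : 2 * ln r%:R <= potential t.1 :> R.
      have -> : 2 * ln r%:R = ln (r%:R ^+ 2) :> R.
        by rewrite lnXn ?ltr0n ?(ltnW r2)// mulr_natl.
      rewrite /potential ler_ln ?posrE ?gauge_gt0 ?gauge_outside//.
      by rewrite exprn_gt0// ltr0n; lia.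
    have : ln (2 ^- 11) <= 0 :> R by rewrite ln_le0//; lra.
    by have := low t; lra.
  - lra.
exists N; apply: le_trans NP _.
have : (4 * p * ln r%:R + Z) / (2 * ln r%:R) <= 2 * p + (1 - 2 * p) / 4.
  rewrite ler_pdivrMr//; lra.
lra.
Qed.

Lemma avoid_small s e : 0 < e -> exists N, avoid q N s < e.
Proof.
have q01 : 0 < q < 1 by move: q_gt q_lt => *; apply/andP; split; lra.
have [t t01 tP] := avoid_bounded; exact: (avoid_to0 q01 t01 tP).
Qed.

End Reaching.

(** * From coin tosses to the walk *)

(** The walk commutes with translations, so that a visit to [v] is a visit to
    the origin of the recentred walk. *)
Definition recenter (v : vertex) (s : state) : state :=
  ((s.1.1 - v.1, s.1.2 - v.2), fun y => s.2 (y.1 + v.1, y.2 + v.2)).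

Lemma hv_step_recenter v b c s :
  hv_step b c (recenter v s) = recenter v (hv_step b c s).
Proof.
case: s v => [[x1 x2] lab] [v1 v2]; rewrite /recenter /hv_step /= !subrK.
congr pair; first by case: (if b then _ else _) => /=; congr pair; ring.
apply/funext => -[y1 y2] /=; congr (if _ then _ else _).
by rewrite !xpair_eqE; congr (_ && _); rewrite [LHS]eq_sym subr_eq eq_sym.
Qed.

Lemma recenter_eq0 v s : ((recenter v s).1 == (0, 0)) = (s.1 == v).
Proof. by case: s v => [[x1 x2] lab] [v1 v2]; rewrite !xpair_eqE !subr_eq0. Qed.

Local Open Scope classical_set_scope.

Section Coins.
Context d (T : measurableType d) (R : realType) (P : probability T R).
Context (q : R) (flip forward : nat -> {RV P >-> bool}).
Hypothesis q01 : 0 < q < 1.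
Hypothesis coins : hv_coins q flip forward.
Variable rho : vertex -> label.

Implicit Types (l : seq (bool * bool)) (v : vertex).

Definition toss_weight (c : bool * bool) : R := (if c.1 then q else 1 - q) / 2.

Definition word_weight l : R := \prod_(c <- l) toss_weight c.

Definition word_state l : state :=
  foldl (fun s c => hv_step c.1 c.2 s) ((0, 0), rho) l.

Definition cylinder l : set T :=
  [set w | forall i, (i < size l)%N ->
     (flip i w, forward i w) = nth (true, true) l i].

Lemma toss_weight01 c : 0 <= toss_weight c <= 1.
Proof.
by move: q01 => /andP[? ?]; rewrite /toss_weight; case: c.1;
  apply/andP; split; lra.
Qed.

Lemma word_weight_le1 l : word_weight l <= 1.
Proof. by apply: prodr_ile1 => c _; exact: toss_weight01. Qed.

Lemma word_weight_rcons l c :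
  word_weight (rcons l c) = word_weight l * toss_weight c.
Proof. by rewrite /word_weight -cats1 big_cat big_seq1. Qed.

Lemma word_state_rcons l c :
  word_state (rcons l c) = hv_step c.1 c.2 (word_state l).
Proof. by rewrite /word_state -cats1 foldl_cat. Qed.

Lemma cylinder_rcons l c : cylinder (rcons l c) =
  cylinder l `&` [set w | (flip (size l) w, forward (size l) w) = c].
Proof.
apply/seteqP; split=> [w lw|w [lw cw] i].
  split=> [i il|].
    by rewrite lw ?size_rcons ?ltnS ?(ltnW il)// nth_rcons il.
  by rewrite /= lw ?size_rcons// nth_rcons ltnn eqxx.
rewrite size_rcons ltnS leq_eqVlt nth_rcons => /predU1P[->|il].
  by rewrite ltnn eqxx.
by rewrite il lw.
Qed.

Lemma word_stateE l w : cylinder l w ->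
  hv_state rho (flip ^~ w) (forward ^~ w) (size l) = word_state l.
Proof.
elim/last_ind: l => [//|l c IH]; rewrite cylinder_rcons => -[lw cw].
by rewrite size_rcons /= IH// word_state_rcons -cw.
Qed.

Lemma measurable_coin (X : {RV P >-> bool}) b : measurable (X @^-1` [set b]).
Proof. by rewrite -[X in measurable X]setTI; exact: measurable_funP. Qed.

Lemma coin_falseE (X : {RV P >-> bool}) (p : R) :
  P (X @^-1` [set true]) = p%:E -> P (X @^-1` [set false]) = (1 - p)%:E.
Proof.
move=> Xp; have -> : X @^-1` [set false] = ~` (X @^-1` [set true]).
  by apply/seteqP; split=> w /=; case: (X w).
by rewrite probability_setC ?Xp//; exact: measurable_coin.
Qed.

Lemma flipE n b : P (flip n @^-1` [set b]) = (if b then q else 1 - q)%:E.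
Proof. by case: coins => fq _ _; case: b => //; exact: coin_falseE. Qed.

Lemma forwardE n b : P (forward n @^-1` [set b]) = (2^-1)%:E.
Proof.
case: coins => _ fq _; case: b => //; rewrite (coin_falseE (fq n)).
by congr EFin; lra.
Qed.

Lemma cylinder_bigcap l : cylinder l =
  \bigcap_(i in [set` [seq inl i | i <- iota 0 (size l)] ++
                      [seq inr i | i <- iota 0 (size l)]])
    (all_coins flip forward i @^-1`
      match i with
      | inl n => [set (nth (true, true) l n).1]
      | inr n => [set (nth (true, true) l n).2]
      end).
Proof.
apply/seteqP; split=> [w lw i|w lw i il].
  rewrite /= mem_cat => /orP[] /mapP[n]; rewrite mem_iota add0n => /andP[_ nl] ->.
    by rewrite /= -lw.
  by rewrite /= -lw.
have := lw (inl i); have := lw (inr i).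
rewrite /= !mem_cat !map_f ?orbT ?mem_iota// => /(_ isT) h2 /(_ isT) h1.
by rewrite h1 h2 -surjective_pairing.
Qed.

Lemma measurable_cylinder l : measurable (cylinder l).
Proof.
rewrite cylinder_bigcap; apply: fin_bigcap_measurable => //.
by move=> [i|i] _; exact: measurable_coin.
Qed.

Lemma cylinderE l : P (cylinder l) = (word_weight l)%:E.
Proof.
rewrite cylinder_bigcap; case: coins => _ _ indep; rewrite indep; first last.
- by move=> [i|i].
- rewrite cat_uniq !map_inj_uniq ?iota_uniq//=; try by move=> ? ? [].
  by rewrite andbT; apply/hasPn => _ /mapP[i _ ->]; apply/mapP => -[].
rewrite big_cat !big_map /=.
under eq_bigr do rewrite flipE.
under [X in (_ * X)%E]eq_bigr do rewrite forwardE.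
rewrite !prodEFin -EFinM -big_split /= /word_weight.
by rewrite (big_nth (true, true)) /index_iota subn0.
Qed.

(** The event that the tosses start with [l] and that the walk stays away from
    [v] between the times [size l] and [size l + N].  As an explicit union of
    cylinders it is visibly measurable, and the recursion is that of [avoid]. *)
Fixpoint evade v N l : set T :=
  if (word_state l).1 == v then set0 else
  if N is M.+1 then
    (evade v M (rcons l (true, true)) `|` evade v M (rcons l (true, false))) `|`
    (evade v M (rcons l (false, true)) `|` evade v M (rcons l (false, false)))
  else cylinder l.

Lemma measurable_evade v N l : measurable (evade v N l).
Proof.
elim: N l => [|N IH] l /=; case: eqP => // _; first exact: measurable_cylinder.
by do !apply: measurableU.
Qed.

Lemma evade_le v N l : (P (evade v N l) <=
  (word_weight l * avoid q N (recenter v (word_state l)))%:E)%E.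
Proof.
elim: N l => [|N IH] l.
  rewrite /= recenter_eq0; case: eqP => _; first by rewrite measure0 mulr0.
  by rewrite cylinderE mulr1.
have [v0|v0] := boolP ((word_state l).1 == v).
  by rewrite /= recenter_eq0 v0 measure0 mulr0.
rewrite avoidS ?recenter_eq0// /avg !hv_step_recenter /= (negPf v0).
have mE := measurable_evade v N.
have leU A B : measurable A -> measurable B ->
    (P (A `|` B) <= P A + P B)%E by exact: measureU2.
apply: le_trans (leU _ _ _ _) _; try by apply: measurableU.
apply: le_trans (leeD (leU _ _ _ _) (leU _ _ _ _)) _ => //.
apply: le_trans (leeD (leeD (IH _) (IH _)) (leeD (IH _) (IH _))) _.
rewrite -!EFinD lee_fin !word_weight_rcons !word_state_rcons /toss_weight /=.
lra.
Qed.

Lemma evade_cover v N l :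
  cylinder l `&` [set w | forall m, (size l <= m)%N ->
    hv_walk rho flip forward m w <> v] `<=` evade v N l.
Proof.
elim: N l => [|N IH] l w [lw wv] /=; case: eqP => [lv|_] //.
- by apply: (wv (size l)) => //; rewrite /hv_walk /hv_position word_stateE.
- by apply: (wv (size l)) => //; rewrite /hv_walk /hv_position word_stateE.
have next : evade v N (rcons l (flip (size l) w, forward (size l) w)) w.
  apply: IH; split; first by rewrite cylinder_rcons.
  by move=> m; rewrite size_rcons => lm; apply: wv; exact: ltnW.
by move: next; case: (flip _ w); case: (forward _ w) => h;
  [left; left|left; right|right; left|right; right].
Qed.

(** The sets [evade v N l] squeeze the event of never returning to [v] after the
    word [l], and their probabilities become arbitrarily small. *)
Lemma negligible_escape v l :
  (forall s e, 0 < e -> exists N, avoid q N s < e) ->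
  P.-negligible (cylinder l `&` [set w | forall m, (size l <= m)%N ->
    hv_walk rho flip forward m w <> v]).
Proof.
have mE := bigcapT_measurable (fun N => measurable_evade v N l).
move=> small; exists (\bigcap_N evade v N l); split => //; last first.
  by move=> w h N _; exact: evade_cover.
have fE : P (\bigcap_N evade v N l) \is a fin_num by exact: fin_num_measure.
apply/eqP; rewrite eq_le measure_ge0 andbT -(fineK fE) lee_fin.
apply/ler_addgt0Pr => e e0; rewrite add0r.
have [N Ne] := small (recenter v (word_state l)) e e0.
rewrite -lee_fin (fineK fE).
apply: (@le_trans _ _ (P (evade v N l))).
  apply: le_measure; rewrite ?inE//; first exact: measurable_evade.
  exact: bigcap_inf.
apply: le_trans (evade_le v N l) _; rewrite lee_fin.
apply: le_trans (ltW Ne); rewrite ler_piMl ?word_weight_le1//.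
exact: avoid_ge0.
Qed.

End Coins.

(** * Recurrence *)

Theorem corollary1p2 (R : realType) (q : R)
    (hq : 2 / 5 < q < 2 / 3)
    (d : measure_display) (T : measurableType d) (P : probability T R)
    (flip forward : nat -> {RV P >-> bool})
    (hcoins : hv_coins q flip forward)
    (rho : vertex -> label) :
  recurrent P (hv_walk rho flip forward).
Proof.
case/andP: hq => q_gt q_lt.
have q01 : 0 < q < 1 by apply/andP; split; lra.
have escape v l := negligible_escape q01 hcoins rho v l (avoid_small q_gt q_lt).
(* A walk that visits [v] finitely often escapes from [v] after any
   word of tosses long enough to cover all its visits. *)
pose escapes k := if unpickle k is Some (v, l) then
  cylinder flip forward l `&` [set w | forall m, (size l <= m)%N ->
    hv_walk rho flip forward m w <> v] else set0.
have : P.-negligible (\bigcup_k escapes k).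
  apply: negligible_bigcup => k; rewrite /escapes.
  by case: unpickle => [[v l]|]; [exact: escape|exact: negligible_set0].
apply: negligibleS => w /= /existsNP[v] /contrapT /finite_seqP[s sE].
pose n := (\max_(i <- s) i).+1%N.
pose l := mkseq (fun i => (flip i w, forward i w)) n.
exists (pickle (v, l)); first exact: I.
rewrite /escapes pickleK; split.
  by move=> i; rewrite size_mkseq => il; rewrite nth_mkseq.
move=> m; rewrite size_mkseq => nm mv.
have ms : m \in s by have : [set` s] m by rewrite -sE.
by move: nm; rewrite /n ltnNge (leq_bigmax_seq (F := id)).
Qed.
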